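(* Let $G=(V,E)$ be an $L$-graph with associated semiflow $\Phi_G$ on $\mathcal{P}(V)$. For a finite collection of nonempty, pairwise disjoint sets $\mathcal{M}=\{\mathcal{M}_\mu\in\mathcal{P}(V):\mu=1,\dots,k\}$ the following statements are equivalent: (1) $\mathcal{M}$ is the finest Morse decomposition of $\Phi_G$; (2) $\mathcal{M}=\mathcal{C}$, the set of communicating classes of $G$.
   Context: A graph $G=(V,E)$ is a finite directed graph without multiple edges, $E\subset V\times V$; it is an $L$-graph if every vertex has at least one outgoing edge. A path of length $n\ge 0$ is a sequence of vertices $\langle i_0\ldots i_n\rangle$ with $(i_p,i_{p+1})\in E$ for $0\le p<n$. Write $i\sim j$ if there are paths of length $\geq 1$ from $i$ to $j$ and from $j$ to $i$ (so $i\sim i$ may fail). Let $V_c=\{i\in V: i\sim j\text{ for some }j\in V\}$; on $V_c$ the relation $\sim$ is an equivalence relation, and its classes $[i]=\{j\in V:j\sim i\}$, $i\in V_c$, are the communicating classes; $\mathcal{C}$ is the set of all of them. The semiflow of $G$ is $\Phi_G:\mathbb{N}\times\mathcal{P}(V)\to\mathcal{P}(V)$ ($\mathbb{N}=\{0,1,\dots\}$), where $\Phi_G(n,A)$ is the set of $j\in V$ for which there is a path of length $n$ from some $i\in A$ to $j$. A set $A\in\mathcal{P}(V)$ is weakly invariant if $\Phi_G(n,A)\cap A\ne\varnothing$ for all $n\in\mathbb{N}$. The $\omega$-limit set is $\omega(A)=\{y\in V:\text{ there are } t_k\to\infty \text{ with } y\in\Phi_G(t_k,A)\}$. A one-point set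 $\{i\}$ is recurrent if there is a sequence $n_l\to\infty$ with $i\in\Phi_G(n_l,\{i\})$; the recurrent set is $\mathcal{R}=\{i\in V:\{i\}\text{ is recurrent}\}$. A finite collection $\mathcal{A}\subset\mathcal{P}(V)$ satisfies the no-cycle condition if for any $l\ge1$ and any members $A_{j_0},\dots,A_{j_l}$ of $\mathcal{A}$, not all equal, with $\omega(A_{j_\alpha})\cap A_{j_{\alpha+1}}\ne\varnothing$ for $\alpha=0,\dots,l-1$, one has $A_{j_0}\neq A_{j_l}$. A Morse decomposition of $\Phi_G$ is a finite collection of nonempty, pairwise disjoint, weakly invariant sets $\mathcal{M}_\mu\in\mathcal{P}(V)$ such that $\mathcal{R}\subset\bigcup_\mu\mathcal{M}_\mu$ and the collection satisfies the no-cycle condition. A Morse decomposition $\mathcal{M}$ is finer than a Morse decomposition $\mathcal{M}'$ if every element of $\mathcal{M}$ is contained in some element of $\mathcal{M}'$; the finest Morse decomposition is the one that is finer than every Morse decomposition. *)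

(* Defs.v *)
(* all_boot comes last so that set0, trivIset, etc. are those of finset. *)
From mathcomp Require Import boolp classical_sets filter.
From mathcomp Require Import all_boot.

Set Implicit Arguments.
Unset Strict Implicit.
Unset Printing Implicit Defensive.

(* A graph is a finite type V of vertices with an edge relation E : rel V, so
   loops are allowed and there are no multiple edges.  Set comprehensions are
   those of finset; the sets defined by Prop-valued conditions are turned into
   elements of {set V} by the classical truth value `[< P >]. *)

Definition L_graph (V : finType) (E : rel V) : Prop :=
  forall i : V, exists j : V, E i j.

(* The path <i_0 ... i_n> is stored as i_0 together with the n-tuple
   (i_1, ..., i_n), so that its length n counts edges. *)
Definition has_path (V : finType) (E : rel V) (n : nat) (i j : V) : bool :=
  [exists p : n.-tuple V, path E i p && (last i p == j)].

Definition comm (V : finType) (E : rel V) (i j : V) : Prop :=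
  (exists2 m : nat, 1 <= m & has_path E m i j) /\
  (exists2 n : nat, 1 <= n & has_path E n j i).

Definition comm_vertices (V : finType) (E : rel V) : {set V} :=
  [set i : V | `[< exists j : V, comm E i j >]].

Definition comm_class (V : finType) (E : rel V) (i : V) : {set V} :=
  [set j : V | `[< comm E j i >]].

Definition comm_classes (V : finType) (E : rel V) : {set {set V}} :=
  [set comm_class E i | i in comm_vertices E].

Definition semiflow (V : finType) (E : rel V) (n : nat) (A : {set V}) :
    {set V} :=
  [set j : V | [exists i in A, has_path E n i j]].

Definition weakly_invariant (V : finType) (E : rel V) (A : {set V}) : Prop :=
  forall n : nat, semiflow E n A :&: A != set0.

Definition omega_limit (V : finType) (E : rel V) (A : {set V}) : {set V} :=
  [set y : V | `[< exists t : nat -> nat,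
      (t @ \oo --> \oo)%classic /\ forall k, y \in semiflow E (t k) A >]].

Definition recurrent (V : finType) (E : rel V) (i : V) : Prop :=
  exists t : nat -> nat,
    (t @ \oo --> \oo)%classic /\ forall l, i \in semiflow E (t l) [set i].

Definition recurrent_set (V : finType) (E : rel V) : {set V} :=
  [set i : V | `[< recurrent E i >]].

(* The members A_{j_0}, ..., A_{j_l} are A 0, ..., A l; the values of A beyond l
   are irrelevant. *)
Definition no_cycle (V : finType) (E : rel V) (M : {set {set V}}) : Prop :=
  forall (l : nat) (A : nat -> {set V}),
    1 <= l ->
    (forall a, a <= l -> A a \in M) ->
    ~ (forall a b, a <= l -> b <= l -> A a = A b) ->
    (forall a, a < l -> omega_limit E (A a) :&: A a.+1 != set0) ->
    A 0 <> A l.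

Definition morse_decomposition (V : finType) (E : rel V) (M : {set {set V}}) :
    Prop :=
  [/\ set0 \notin M,
      trivIset M,
      forall A : {set V}, A \in M -> weakly_invariant E A,
      recurrent_set E \subset cover M
    & no_cycle E M].

Definition finer (V : finType) (M M' : {set {set V}}) : Prop :=
  forall A : {set V}, A \in M -> exists2 B : {set V}, B \in M' & A \subset B.

Definition finest_morse_decomposition (V : finType) (E : rel V)
    (M : {set {set V}}) : Prop :=
  morse_decomposition E M /\
  forall M' : {set {set V}}, morse_decomposition E M' -> finer M M'.

(* Main.v *)
Require Import Defs.
From mathcomp Require Import boolp classical_sets filter.
From mathcomp Require Import all_boot.

Set Implicit Arguments.
Unset Strict Implicit.
Unset Printing Implicit Defensive.

(** A vertex is recurrent iff it lies on a closed path of positive length, and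
    a communicating class sends arbitrarily long paths to each of its members.
    Hence two elements of a Morse decomposition meeting the same class would
    form a cycle of length 2, so every class lies in a single element: the
    classes refine every Morse decomposition. They form a Morse decomposition
    themselves, because a cycle of omega-limit connections between classes makes
    them all communicate. Two collections of nonempty disjoint sets refining each
    other are equal, which gives the equivalence. *)

(* Trades the sequence t_k in omega_limit and recurrent for cofinality, so that
   only path lengths remain. *)
Lemma cvg_infty_seqP (P : pred nat) :
  (exists t : nat -> nat, (t @ \oo --> \oo)%classic /\ forall k, P (t k)) <->
  (forall N, exists2 n, N <= n & P n).
Proof.
split=> [[t [t_oo Pt]] N | large_P].
  have [k _ le_N_t]: (t @ \oo)%classic (fun n => N <= n).
    by apply: t_oo; exists N.
  by exists (t k) => //; apply: le_N_t => /=.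
have large_P1 N : exists n, (N <= n) && P n.
  by have [n le_Nn Pn] := large_P N; exists n; rewrite le_Nn.
(* Take for [t k] the least [n >= k] satisfying [P]; the bound [k <= t k] forces divergence. *)
exists (fun k => ex_minn (large_P1 k)); split=> [A [N _ sNA] | k]; last first.
  by case: ex_minnP => n /andP[].
exists N => // k /= le_Nk; apply: sNA => /=.
by case: ex_minnP => n /andP[le_kn _] _; apply: leq_trans le_kn.
Qed.

Section Walks.

Variables (V : finType) (E : rel V).

Lemma has_pathP n i j :
  reflect (exists p : seq V, [/\ size p = n, path E i p & last i p = j])
          (has_path E n i j).
Proof.
apply: (iffP existsP) => [[p /andP[Ep /eqP pj]] | [p [<- Ep pj]]].
  by exists p; rewrite size_tuple.
by exists (in_tuple p); rewrite /= Ep pj eqxx.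
Qed.

Lemma has_path0 i : has_path E 0 i i.
Proof. by apply/has_pathP; exists [::]. Qed.

Lemma has_pathD m n i k :
  has_path E (m + n) i k <-> exists2 j, has_path E m i j & has_path E n j k.
Proof.
split=> [/has_pathP[p [sz_p Ep pk]] | [j /has_pathP[p [<- Ep pj]]]].
  move: Ep pk; rewrite -{1 2}(cat_take_drop m p) cat_path last_cat.
  case/andP=> Ep1 Ep2 pk; exists (last i (take m p)); apply/has_pathP.
    by exists (take m p); split; rewrite // size_takel // sz_p leq_addr.
  by exists (drop m p); rewrite size_drop sz_p addKn.
case/has_pathP=> q [<- Eq qk]; apply/has_pathP; exists (p ++ q).
by rewrite size_cat cat_path last_cat Ep pj.
Qed.

Lemma has_path_mul k n i : has_path E n i i -> has_path E (k * n) i i.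
Proof.
move=> Eii; elim: k => [|k IHk]; first exact: has_path0.
by rewrite mulSn; apply/has_pathD; exists i.
Qed.

(** One half of [comm]: [comm E i j] is by conversion [reach i j /\ reach j i]. Lengths are
    positive, so [reach i i] may fail. *)
Definition reach i j := exists2 n, 1 <= n & has_path E n i j.

Lemma reach_trans j i k : reach i j -> reach j k -> reach i k.
Proof.
case=> m m_gt0 Eij [n n_gt0 Ejk]; exists (m + n); first by rewrite addn_gt0 m_gt0.
by apply/has_pathD; exists j.
Qed.

Lemma comm_sym i j : comm E i j -> comm E j i.
Proof. by case. Qed.

Lemma comm_trans j i k : comm E i j -> comm E j k -> comm E i k.
Proof.
case=> ij ji [jk kj]; split; first exact: reach_trans ij jk.
exact: reach_trans kj ji.
Qed.

Lemma comm_refl i j : comm E i j -> comm E i i.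
Proof. by move=> ij; apply: comm_trans (comm_sym ij). Qed.

(** Going [N] times round a closed path at [i] before leaving for [j] takes at least [N] steps,
    since each turn has positive length. *)
Lemma reach_long i j :
  reach i i -> reach i j -> forall N, exists2 n, N <= n & has_path E n i j.
Proof.
case=> m m_gt0 Eii [n n_gt0 Eij] N; exists (N * m + n).
  by rewrite (leq_trans (leq_pmulr N m_gt0)) ?leq_addr.
by apply/has_pathD; exists i; first exact: has_path_mul.
Qed.

Lemma mem_semiflow n (A : {set V}) j :
  reflect (exists2 i, i \in A & has_path E n i j) (j \in semiflow E n A).
Proof. by rewrite inE; apply: exists_inP. Qed.

Lemma mem_omega_limit (A : {set V}) y :
  y \in omega_limit E A <-> forall N, exists2 n, N <= n & y \in semiflow E n A.
Proof.
rewrite -(cvg_infty_seqP (fun n => y \in semiflow E n A)).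
by rewrite inE; split=> /asboolP.
Qed.

Lemma mem_recurrent_set i : i \in recurrent_set E <-> comm E i i.
Proof.
rewrite inE; split=> [/asboolP|[ii _]].
  case/(cvg_infty_seqP (fun n => i \in semiflow E n [set i]))/(_ 1) => n n_gt0.
  by case/mem_semiflow=> _ /set1P-> Eii; split; exists n.
apply/asboolP/(cvg_infty_seqP (fun n => i \in semiflow E n [set i])) => N.
have [n le_Nn Eii] := reach_long ii ii N.
by exists n => //; apply/mem_semiflow; exists i; rewrite ?set11.
Qed.

Lemma omega_limit_reach (A : {set V}) y :
  y \in omega_limit E A -> exists2 i, i \in A & reach i y.
Proof.
case/mem_omega_limit/(_ 1)=> n n_gt0 /mem_semiflow[i Ai Eiy].
by exists i => //; exists n.
Qed.

Lemma omega_limit_comm (A : {set V}) i y :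
  i \in A -> comm E i y -> y \in omega_limit E A.
Proof.
move=> Ai iy; have [[ii _] [riy _]] := (comm_refl iy, iy).
apply/mem_omega_limit => N; have [n le_Nn Eiy] := reach_long ii riy N.
by exists n => //; apply/mem_semiflow; exists i.
Qed.

Lemma mem_comm_class i j : j \in comm_class E i <-> comm E j i.
Proof. by rewrite inE; split=> /asboolP. Qed.

Lemma comm_class_eq i j : comm E i j -> comm_class E i = comm_class E j.
Proof.
move=> ij; apply/setP=> k; apply/idP/idP => /mem_comm_class k_i;
  apply/mem_comm_class; apply: comm_trans k_i _ => //; exact: comm_sym.
Qed.

Lemma comm_classesP (A : {set V}) :
  A \in comm_classes E <-> exists2 i, comm E i i & A = comm_class E i.
Proof.
split=> [/imsetP[i] | [i ii ->]].
  by rewrite inE => /asboolP[j /comm_refl ii] ->; exists i.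
by apply/imset_f; rewrite inE; apply/asboolP; exists i.
Qed.

Lemma comm_classes_eq (A : {set V}) i :
  A \in comm_classes E -> i \in A -> A = comm_class E i.
Proof.
by case/comm_classesP=> j jj -> /mem_comm_class /comm_class_eq.
Qed.

Lemma set0_comm_classes : set0 \notin comm_classes E.
Proof.
apply/negP=> /comm_classesP[i ii /setP/(_ i)]; rewrite in_set0 => /esym/negP.
by case; apply/mem_comm_class.
Qed.

Lemma trivIset_comm_classes : trivIset (comm_classes E).
Proof.
apply/trivIsetP=> A B CA CB; apply: contraR => /pred0Pn[i /andP[Ai Bi]].
by rewrite (comm_classes_eq CA Ai) (comm_classes_eq CB Bi).
Qed.

(** Following a closed path at [i] never leaves the class: each vertex met on it is reached from [i]
    and leads back to [i]. *)
Lemma weakly_invariant_comm_class i :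
  comm E i i -> weakly_invariant E (comm_class E i).
Proof.
move=> ii [|n]; apply/set0Pn.
  exists i; apply/setIP; split; last exact/mem_comm_class.
  by apply/mem_semiflow; exists i; [apply/mem_comm_class | apply: has_path0].
have [[b b_gt0 Eii] _] := ii.
(* Going round [n.+2] times is strictly longer than [n.+1] steps, so the way back has length
   [c >= 1], as [comm] requires. *)
have [c c_gt0 def_c]: exists2 c, 1 <= c & n.+2 * b = n.+1 + c.
  have le_n2 : n.+2 <= n.+2 * b by rewrite leq_pmulr.
  exists (n.+2 * b - n.+1); first by rewrite subn_gt0.
  by rewrite subnKC // ltnW.
have := has_path_mul n.+2 Eii; rewrite def_c => /has_pathD[j Eij Eji].
exists j; apply/setIP; split; last first.
  by apply/mem_comm_class; split; [exists c | exists n.+1].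
by apply/mem_semiflow; exists i => //; apply/mem_comm_class.
Qed.

Lemma no_cycle_comm_classes : no_cycle E (comm_classes E).
Proof.
move=> l A l_gt0 CA A_neq A_next A0l; apply: A_neq.
(* The omega-limit only links some [x] of [A a] to some [y] of [A a.+1]; communication inside both
   classes extends this to all pairs. *)
have step a i j : a < l -> i \in A a -> j \in A a.+1 -> reach i j.
  move=> lt_al Ai Aj; have /set0Pn[y /setIP[/omega_limit_reach[x Ax xy] Ay]] :=
    A_next a lt_al.
  have same k u v : k <= l -> u \in A k -> v \in A k -> reach u v.
    move=> le_kl Au; rewrite (comm_classes_eq (CA k le_kl) Au).
    by case/mem_comm_class.
  apply: reach_trans (same a i x (ltnW lt_al) Ai Ax) _.
  exact: reach_trans xy (same a.+1 y j lt_al Ay Aj).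
have inh a : a <= l -> exists i, i \in A a.
  move/CA=> CAa; apply/set0Pn; apply: contraNneq set0_comm_classes.
  by move=> <-.
have chain a b i j :
    a < b -> b <= l -> i \in A a -> j \in A b -> reach i j.
  elim: b j => // b IHb j; rewrite ltnS leq_eqVlt => /predU1P[<-|lt_ab] lt_bl Ai Aj.
    exact: step Aj.
  have [k Ak] := inh b (ltnW lt_bl).
  exact: reach_trans (IHb k lt_ab (ltnW lt_bl) Ai Ak) (step _ _ _ lt_bl Ak Aj).
have A0 a : a <= l -> A a = A 0.
  move=> le_al; case: (posnP a) => [-> //|a_gt0].
  move: le_al; rewrite leq_eqVlt => /predU1P[-> //|lt_al].
  have [[i Ai] [j Aj]] := (inh a (ltnW lt_al), inh 0 (leq0n l)).
  rewrite (comm_classes_eq (CA a (ltnW lt_al)) Ai).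
  rewrite (comm_classes_eq (CA 0 (leq0n l)) Aj).
  apply: comm_class_eq; split; last exact: chain (ltnW lt_al) Aj Ai.
  (* The assumed equality [A 0 = A l] closes the chain: going forward from [A a] to [A l] returns to
     [A 0]. *)
  by apply: (chain a l) => //; rewrite -A0l.
by move=> a b le_al le_bl; rewrite !A0.
Qed.

Lemma morse_decomposition_comm_classes :
  morse_decomposition E (comm_classes E).
Proof.
split; [exact: set0_comm_classes | exact: trivIset_comm_classes | | |
        exact: no_cycle_comm_classes].
  by move=> A /comm_classesP[i ii ->]; apply: weakly_invariant_comm_class.
apply/subsetP=> i /mem_recurrent_set ii; apply/bigcupP.
by exists (comm_class E i); [apply/comm_classesP; exists i | apply/mem_comm_class].
Qed.

Lemma comm_classes_finer (M : {set {set V}}) :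
  morse_decomposition E M -> finer (comm_classes E) M.
Proof.
case=> _ _ _ covM no_cycM _ /comm_classesP[i ii ->].
(* Self-communicating vertices are recurrent, hence covered by [M]. *)
have block j : comm E j j -> exists2 B, B \in M & j \in B.
  by move/mem_recurrent_set/(subsetP covM)/bigcupP.
have [B MB Bi] := block i ii; exists B => //.
apply/subsetP=> j /mem_comm_class ji; have ij := comm_sym ji.
have [B' MB' B'j] := block j (comm_refl ji).
have [<- // | neq_B] := eqVneq B' B; exfalso.
(* The forbidden cycle is [B], [B'], [B]: [j] lies in the omega-limit of [B] and [i] in that of
   [B'], because [i] and [j] communicate. *)
apply: (no_cycM 2 (fun a => if a == 1 then B' else B)) => //.
- by move=> a _; case: ifP.
- by move/(_ 1 0 isT isT)=> /= eqB; rewrite eqB eqxx in neq_B.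
case=> [|[|a]] //= _; apply/set0Pn.
  by exists j; rewrite inE B'j (omega_limit_comm Bi).
by exists i; rewrite inE Bi (omega_limit_comm B'j).
Qed.

End Walks.

(** Refining both ways sandwiches a member [B] of [N] between members [A] and [A'] of [M]; these
    share the nonempty [A], so disjointness gives [A = A'], hence [A = B]. *)
Lemma finer_subset (V : finType) (M N : {set {set V}}) :
  set0 \notin M -> trivIset M -> finer M N -> finer N M -> M \subset N.
Proof.
move=> M0 /trivIsetP tiM MN NM; apply/subsetP=> A MA.
have [B NB sAB] := MN A MA; have [A' MA' sBA'] := NM B NB.
have [eqA | neqA] := eqVneq A A'.
  suff -> : A = B by [].
  by apply/eqP; rewrite eqEsubset sAB eqA.
have A_neq0 : A != set0 by apply: contraNneq M0 => <-.
have := tiM A A' MA MA' neqA; rewrite -setI_eq0.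
by rewrite (setIidPl (subset_trans sAB sBA')) (negPf A_neq0).
Qed.

Theorem theorem3p14 (V : finType) (E : rel V) (hL : L_graph E)
    (M : {set {set V}}) (hM0 : set0 \notin M) (hMd : trivIset M) :
  finest_morse_decomposition E M <-> M = comm_classes E.
Proof.
split=> [[morseM finestM] | ->]; last first.
  split; first exact: morse_decomposition_comm_classes.
  exact: comm_classes_finer.
(* The classes are themselves a Morse decomposition, so [M] refines them; they refine [M] in turn,
   and mutual refinement gives both inclusions. *)
have MC := finestM _ (morse_decomposition_comm_classes E).
have CM := comm_classes_finer morseM.
apply/eqP; rewrite eqEsubset !finer_subset //.
  exact: set0_comm_classes.
exact: trivIset_comm_classes.
Qed.
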